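(* For any positive integer $s$, any $\lambda_1,\lambda_2\in(0,1)$, and any irrational $\Phi$, the operator $\mathcal{E}^{\rm mosaic}_{s,\lambda_1,\lambda_2,\Phi,\theta}$ has empty point spectrum (no eigenvalues on $\ell^2(\mathbb{Z})$) for generic $\theta\in\mathbb{T}$.
   Context: $\mathbb{T}=\mathbb{R}/\mathbb{Z}$. ''Generic $\theta$'' means all $\theta$ in a dense $G_\delta$ subset of $\mathbb{T}$. Given $\alpha,\rho\in\mathbb{C}^{\mathbb{Z}}$ with $|\alpha_n|^2+|\rho_n|^2=1$ for all $n$ (such $\rho$ is called admissible), the generalized extended CMV matrix $\mathcal{E}_{\alpha,\rho}$ is the unitary operator on $\ell^2(\mathbb{Z})$ given by $$[\mathcal{E}_{\alpha,\rho}u](2n)=\overline{\alpha_{2n}}\big[\overline{\rho_{2n-1}}u(2n-1)-\alpha_{2n-1}u(2n)\big]+\rho_{2n}\big[\overline{\alpha_{2n+1}}u(2n+1)+\rho_{2n+1}u(2n+2)\big],$$ $$[\mathcal{E}_{\alpha,\rho}u](2n+1)=\overline{\rho_{2n}}\big[\overline{\rho_{2n-1}}u(2n-1)-\alpha_{2n-1}u(2n)\big]-\alpha_{2n}\big[\overline{\alpha_{2n+1}}u(2n+1)+\rho_{2n+1}u(2n+2)\big].$$ The mosaic operator $\mathcal{E}^{\rm mosaic}_{s,\lambda_1,\lambda_2,\Phi,\theta}$ is the generalized extended CMV matrix with $$\alpha_{2n}=(1-\lambda_1^2)^{1/2},\qquad \alpha_{2n-1}=\begin{cases}\lambda_2\cos(2\pi(n\Phi+\theta))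 & n\in s\mathbb{Z},\\ 0&\text{otherwise},\end{cases}$$ and an admissible $\rho$ (matrices with the same $\alpha$ and different admissible $\rho$ are unitarily equivalent via a diagonal gauge transformation, so the choice of $\rho$ is immaterial; e.g. $\rho_n=\sqrt{1-|\alpha_n|^2}$). *)

(* Defs.v *)
From HB Require Import structures.
From mathcomp Require Import all_boot all_order all_algebra.
From mathcomp Require Import complex.
From mathcomp Require Import all_classical all_reals all_analysis.
From mathcomp Require Import borel_hierarchy.
Import Order.TTheory GRing.Theory Num.Theory.
Import numFieldNormedType.Exports.

Set Implicit Arguments.
Unset Strict Implicit.
Unset Printing Implicit Defensive.

Local Open Scope classical_set_scope.
Local Open Scope ring_scope.
Local Open Scope quotient_scope.

Section Circle.
Variable R : realType.

Definition eqmod1 (x y : R) : bool := x - y \is a Num.int.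

Lemma eqmod1_equiv : equiv_class_of eqmod1.
Proof.
split=> [x|x y|y x z]; rewrite /eqmod1.
- by rewrite subrr rpred0.
- by rewrite -opprB rpredN.
- by move=> xy yz; have := rpredD xy yz; rewrite addrA subrK.
Qed.

Canonical eqmod1_equiv_rel := EquivRelPack eqmod1_equiv.

Definition circle : topologicalType := quotient_topology {eq_quot eqmod1}.

Definition circle_pi (x : R) : circle := \pi_({eq_quot eqmod1}) x.

End Circle.

Section CMV.
Variable R : realType.
Implicit Types (alpha rho u : int -> R[i]).

Definition l2 : set (int -> R[i]) :=
  [set u | summable [set: int] (fun n => (Normc.normc (u n) ^+ 2)%:E)].

(* Operators on l2 are given by formulas on all of C^Z; membership of the
   eigenvector in l2 is required here. *)
Definition point_spectrum (T : (int -> R[i]) -> (int -> R[i])) : set R[i] :=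
  [set z | exists u, [/\ l2 u, u != 0 & forall n, T u n = z * u n]].

Definition admissible alpha rho : Prop :=
  forall n, `|alpha n| ^+ 2 + `|rho n| ^+ 2 = 1.

(* The site is m = 2n or m = 2n + 1, since %/ on int is here the floor. *)
Definition gecmv alpha rho u : int -> R[i] := fun m =>
  let n := (m %/ 2)%Z in
  let v := (rho (2 * n - 1))^* * u (2 * n - 1) - alpha (2 * n - 1) * u (2 * n) in
  let w := (alpha (2 * n + 1))^* * u (2 * n + 1)
           + rho (2 * n + 1) * u (2 * n + 2) in
  if (2 %| m)%Z then (alpha (2 * n))^* * v + rho (2 * n) * w
  else (rho (2 * n))^* * v - alpha (2 * n) * w.

(* An odd site is written m = 2n - 1, so that n = (m + 1) / 2. *)
Definition mosaic_alpha (s : nat) (lambda1 lambda2 Phi theta : R) :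
    int -> R[i] := fun m =>
  if (2 %| m)%Z then (Num.sqrt (1 - lambda1 ^+ 2))%:C%C
  else let n := ((m + 1) %/ 2)%Z in
    if (s %| n)%Z then (lambda2 * cos (2 * pi * (n%:~R * Phi + theta)))%:C%C
    else 0.

End CMV.

(* Main.v *)
(* The potential is a sampled cosine, so for a generic phase it is almost
   symmetric, with super-exponential precision, about infinitely many centres.
   Write E = L M. Given E u = z u, the pair (u, M u) obeys a 2x2 transfer
   recursion, and reflecting it about such a centre (with alternating signs)
   gives an almost solution of the same recursion. Their Wronskian is almost
   constant up to sign and tends to 0, so it is tiny at the centre, where it
   equals, up to sign, r (u_-^2 + u_+^2); hence u_- is close to i u_+ or to
   - i u_+, that is, the reflected solution is close to a unimodular multiple
   of the solution at the centre. The transfer matrices grow at most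
   exponentially, so this persists from the centre to the mirror image of any
   fixed site m; hence |u(m)| is close to |u| at that mirror image, which tends
   to 0 as the centre moves to infinity. Thus u = 0. *)

Require Import Defs.
From mathcomp Require Import all_boot all_order all_algebra.
From mathcomp Require Import complex.
From mathcomp Require Import all_classical all_reals all_analysis.
From mathcomp Require Import borel_hierarchy.
From mathcomp Require Import ring lra zify.
Import Order.TTheory GRing.Theory Num.Theory.
Import numFieldNormedType.Exports.

Set Implicit Arguments.
Unset Strict Implicit.
Unset Printing Implicit Defensive.

Local Open Scope classical_set_scope.
Local Open Scope ring_scope.

(** * Transfer matrices, their Wronskian and norm bounds *)

Section Transfer.
Variable R : realType.
Local Notation C := R[i].
Local Notation nrm := (@Normc.normc R).

Lemma nrm_ge0 (x : C) : 0 <= nrm x.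
Proof. by case: x => a b; exact: sqrtr_ge0. Qed.

Lemma nrmM (x y : C) : nrm (x * y) = nrm x * nrm y.
Proof. exact: Normc.normcM. Qed.

Lemma nrmN (x : C) : nrm (- x) = nrm x.
Proof. exact: normcN. Qed.

Lemma nrmD (x y : C) : nrm (x + y) <= nrm x + nrm y.
Proof. exact: le_normcD. Qed.

Lemma nrmB (x y : C) : nrm (x - y) <= nrm x + nrm y.
Proof. by rewrite -(nrmN y) nrmD. Qed.

Lemma nrm_real (x : R) : nrm x%:C%C = `|x|.
Proof. by rewrite /Normc.normc /= expr0n /= addr0 sqrtr_sqr. Qed.

Lemma normE (x : C) : `|x| = (nrm x)%:C%C.
Proof. by []. Qed.

Lemma nrm_eq0 (x : C) : (nrm x == 0) = (x == 0).
Proof.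
by apply/eqP/eqP => [|->]; [exact: Normc.eq0_normc | exact: Normc.normc0].
Qed.

Definition size1 (x : C * C) : R := nrm x.1 + nrm x.2.

Definition wronskian (x y : C * C) : C := x.1 * y.2 - x.2 * y.1.

(* One step of the eigenvalue equation E u = L M u = z u, for (u, M u). *)
Definition transfer (z a r : C) (x : C * C) : C * C :=
  ((z^-1 * x.2 - a * x.1) / r, (z * x.1 - a * x.2) / r).

Lemma size1_ge0 x : 0 <= size1 x.
Proof. by rewrite addr_ge0 // nrm_ge0. Qed.

Lemma size1D x y : size1 (x + y) <= size1 x + size1 y.
Proof.
rewrite /size1 /=; have := nrmD x.1 y.1; have := nrmD x.2 y.2; lra.
Qed.

Lemma wronskianDr x y y' :
  wronskian x (y + y') = wronskian x y + wronskian x y'.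
Proof. by rewrite /wronskian /=; ring. Qed.

Lemma wronskian_le x y : nrm (wronskian x y) <= size1 x * size1 y.
Proof.
apply: le_trans (nrmB _ _) _; rewrite !nrmM /size1.
have := nrm_ge0 x.1; have := nrm_ge0 x.2; have := nrm_ge0 y.1.
have := nrm_ge0 y.2; nra.
Qed.

(** The transfer matrix has determinant [(a^2 - 1) / r^2 = -1]. *)
Lemma wronskian_transfer z a r x y : z != 0 -> r != 0 -> r ^+ 2 = 1 - a ^+ 2 ->
  wronskian (transfer z a r x) (transfer z a r y) = - wronskian x y.
Proof.
move=> z0 r0 ra; rewrite /wronskian /transfer /=.
have -> : (z^-1 * x.2 - a * x.1) / r * ((z * y.1 - a * y.2) / r)
  - (z * x.1 - a * x.2) / r * ((z^-1 * y.2 - a * y.1) / r)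
  = - (1 - a ^+ 2) * (x.1 * y.2 - x.2 * y.1) / r ^+ 2.
  by field; rewrite z0 r0.
by rewrite -ra; field.
Qed.

Lemma transfer_lin z a r t x y :
  transfer z a r (x - t *: y) = transfer z a r x - t *: transfer z a r y.
Proof.
rewrite /transfer /=; congr pair => /=.
  by rewrite /GRing.scale /=; ring.
by rewrite /GRing.scale /=; ring.
Qed.

Lemma transfer_le z a r x (Z k : R) : 0 < k -> 1 <= Z ->
  nrm z <= Z -> nrm z^-1 <= Z -> nrm a <= 1 -> k <= nrm r ->
  size1 (transfer z a r x) <= (Z + 1) / k * size1 x.
Proof.
move=> k0 Z1 hz hzi ha hr; have r0 : 0 < nrm r by lra.
rewrite /size1 /= !nrmM !Normc.normcV.
have kr : (nrm r)^-1 <= k^-1 by rewrite lef_pV2.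
have ri : 0 < (nrm r)^-1 by rewrite invr_gt0.
set A := nrm (_ - _); set B := nrm (_ - _).
have hA : A <= Z * nrm x.2 + nrm x.1.
  apply: le_trans (nrmB _ _) _; rewrite !nrmM lerD //.
    by rewrite ler_wpM2r ?nrm_ge0.
  by rewrite ler_piMl ?nrm_ge0.
have hB : B <= Z * nrm x.1 + nrm x.2.
  apply: le_trans (nrmB _ _) _; rewrite !nrmM lerD //.
    by rewrite ler_wpM2r ?nrm_ge0.
  by rewrite ler_piMl ?nrm_ge0.
have A0 : 0 <= A by exact: nrm_ge0.
have B0 : 0 <= B by exact: nrm_ge0.
rewrite -mulrDl mulrAC; apply: ler_pM => //; [exact: addr_ge0 | exact: ltW | lra].
Qed.

Lemma sqr_le_id (q H : R) : 0 <= H -> q ^+ 2 <= H -> q <= 1 + H.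
Proof. by move=> H0 qH; have := sqr_ge0 (q - 1); lra. Qed.

(** * An exact solution [x] against an almost solution [y] on a half-line *)

Section Perturbed.
Variables (x y : nat -> C * C) (z a r : nat -> C) (A e H : R).
Hypothesis z0 : forall j, z j != 0.
Hypothesis r0 : forall j, r j != 0.
Hypothesis ra : forall j, r j ^+ 2 = 1 - a j ^+ 2.
Hypothesis A2 : 2 <= A.
Hypothesis hA : forall j p, size1 (transfer (z j) (a j) (r j) p) <= A * size1 p.
Hypothesis hx : forall j, x j.+1 = transfer (z j) (a j) (r j) (x j).
Hypothesis e0 : 0 <= e.
Hypothesis hy : forall j,
  size1 (y j.+1 - transfer (z j) (a j) (r j) (y j)) <= e * size1 (y j).
Hypothesis Hx : forall n, \sum_(j < n) size1 (x j) ^+ 2 <= H.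
Hypothesis Hy : forall n, \sum_(j < n) size1 (y j) ^+ 2 <= H.

Let Hx1 j : size1 (x j) ^+ 2 <= H.
Proof.
apply: le_trans (Hx j.+1); rewrite big_ord_recr /= lerDr.
by apply: sumr_ge0 => i _; exact: sqr_ge0.
Qed.

Let Hy1 j : size1 (y j) ^+ 2 <= H.
Proof.
apply: le_trans (Hy j.+1); rewrite big_ord_recr /= lerDr.
by apply: sumr_ge0 => i _; exact: sqr_ge0.
Qed.

Let H0 : 0 <= H.
Proof. exact: le_trans (sqr_ge0 _) (Hx1 0). Qed.

(** Were [y] an exact solution, the Wronskian would only change sign. The defect of [y], at most
    [e * size1 (y j)], is paired with [x j.+1], of size at most [A * size1 (x j)]. *)
Lemma wronskian_step j : nrm (wronskian (x j) (y j)) <=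
  nrm (wronskian (x j.+1) (y j.+1)) + A * e * (size1 (x j) * size1 (y j)).
Proof.
set T := transfer (z j) (a j) (r j).
have := wronskian_transfer (x j) (y j) (z0 j) (r0 j) (ra j).
rewrite -/T -[T (x j)]hx -[T (y j)](subrK (y j.+1)) addrC wronskianDr => h.
rewrite -nrmN -h; apply: le_trans (nrmD _ _) _; rewrite lerD2l.
apply: le_trans (wronskian_le _ _) _.
have -> : T (y j) - y j.+1 = - (y j.+1 - T (y j)) by rewrite opprB.
rewrite /size1 /= !nrmN -/(size1 (y j.+1 - T (y j))) hx.
rewrite -/(size1 (T (x j))) -/(size1 (x j)) -/(size1 (y j)).
have -> : A * e * (size1 (x j) * size1 (y j)) =
  (A * size1 (x j)) * (e * size1 (y j)) by ring.
exact: ler_pM (size1_ge0 _) (size1_ge0 _) (hA _ _) (hy _).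
Qed.

Lemma wronskian_sum n : nrm (wronskian (x 0) (y 0)) <=
  nrm (wronskian (x n) (y n)) + A * e * \sum_(j < n) (size1 (x j) * size1 (y j)).
Proof.
elim: n => [|n ih]; first by rewrite big_ord0 mulr0 addr0.
apply: le_trans ih _; rewrite big_ord_recr /= mulrDr.
by have := wronskian_step n; lra.
Qed.

(** Otherwise [size1 (x j) ^+ 2 + size1 (y j) ^+ 2] would be at least [d] at every step, and its
    partial sums would exceed [H + H]. *)
Lemma wronskian_small_infinitely_often (d : R) : 0 < d ->
  exists n, nrm (wronskian (x n) (y n)) <= d.
Proof.
move=> d0; apply: contrapT => /forallNP hn.
have hW j : d <= size1 (x j) ^+ 2 + size1 (y j) ^+ 2.
  have /negP := hn j; rewrite -ltNge => /ltW /le_trans; apply.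
  apply: le_trans (wronskian_le _ _) _.
  have := size1_ge0 (x j); have := size1_ge0 (y j); nra.
set n := (Num.truncn ((H + H) / d)).+1.
have : \sum_(j < n) d <= H + H.
  apply: le_trans (lerD (Hx n) (Hy n)); rewrite -big_split.
  by apply: ler_sum => j _; exact: hW.
rewrite sumr_const card_ord -mulr_natl.
have : (H + H) / d < n%:R.
  exact: truncnS_gt.
rewrite ltr_pdivrMr //; lra.
Qed.

(** Sum the steps up to an index where the Wronskian is at most an arbitrary [d]; the inequality
    [2 x y <= x^2 + y^2] bounds the accumulated products by [H]. *)
Lemma wronskian0_le : nrm (wronskian (x 0) (y 0)) <= A * e * H.
Proof.
apply/ler_addgt0Pr => d /wronskian_small_infinitely_often [n hn].
apply: le_trans (wronskian_sum n) _; rewrite addrC lerD // ler_wpM2l //.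
  by rewrite mulr_ge0 // (le_trans _ A2).
have : \sum_(j < n) (size1 (x j) * size1 (y j)) *+ 2 <= H + H.
  apply: le_trans (lerD (Hx n) (Hy n)); rewrite -big_split.
  apply: ler_sum => j _ /=; have := sqr_ge0 (size1 (x j) - size1 (y j)); lra.
by rewrite sumrMnl; lra.
Qed.

(** Each step adds at most [B = e * (1 + H)] to the error, since [size1 (y n) <= 1 + H]. Carrying
    [B] on both sides makes this affine recursion geometric, because [2 * B <= A * B]. *)
Lemma size1_combination_le t n : size1 (y n - t *: x n) + e * (1 + H) <=
  A ^+ n * (size1 (y 0 - t *: x 0) + e * (1 + H)).
Proof.
set B := e * (1 + H).
have B0 : 0 <= B by rewrite mulr_ge0 // addr_ge0.
elim: n => [|n ih]; first by rewrite expr0 mul1r.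
rewrite exprS -mulrA.
have A0 : 0 <= A by exact: le_trans A2.
apply: le_trans (ler_wpM2l A0 ih).
set T := transfer (z n) (a n) (r n).
have -> : y n.+1 - t *: x n.+1 = T (y n - t *: x n) + (y n.+1 - T (y n)).
  rewrite [T (_ - _)]transfer_lin -hx.
  by rewrite -/T [RHS]addrC addrA subrK.
have h1 := size1D (T (y n - t *: x n)) (y n.+1 - T (y n)).
have h2 := hA n (y n - t *: x n); rewrite -/T in h2.
have h3 := hy n; rewrite -/T in h3.
have h4 : e * size1 (y n) <= B by rewrite ler_wpM2l ?sqr_le_id.
have h5 : 2 * B <= A * B by rewrite ler_wpM2r.
rewrite mulrDr; apply: le_trans (lerD h2 h5).
rewrite [2 * B]mulr_natl mulr2n [leRHS]addrA lerD2r.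
by rewrite (le_trans h1) // lerD2l (le_trans h3).
Qed.

(* Here [(um, vm)] and [(up, vp)] are the values at the two central sites.
   The Wronskian there factors as - rc (um - i up) (um + i up), so one of the
   two factors is small. *)
Lemma reflection_bound (um vm up vp ac rc : C) (k : R) n :
  rc ^+ 2 = 1 - ac ^+ 2 -> 0 < k -> k <= nrm rc -> nrm rc <= 1 -> nrm ac <= 1 ->
  vm = ac * um + rc * up -> vp = rc * um - ac * up ->
  x 0 = (up, vp) -> y 0 = (um, - vm) ->
  nrm (y n).1 <= nrm (x n).1 +
    A ^+ n * (3 * Num.sqrt (A * e * H / k) + e * (1 + H)).
Proof.
move=> rca k0 krc rc1 ac1 hvm hvp x0 y0.
have W0 : nrm (wronskian (x 0) (y 0)) <= A * e * H by exact: wronskian0_le.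
have hW : wronskian (x 0) (y 0) = - (rc * (um - 'i%C * up) * (um + 'i%C * up)).
  have hi : 'i%C ^+ 2 = -1 :> C by rewrite sqr_i.
  rewrite x0 y0 /wronskian /= hvm hvp.
  have -> : rc * (um - 'i%C * up) * (um + 'i%C * up) =
    rc * (um ^+ 2 - 'i%C ^+ 2 * up ^+ 2) by ring.
  by rewrite hi; ring.
rewrite hW nrmN !nrmM in W0.
set q := Num.sqrt _.
have q0 : 0 <= q by exact: sqrtr_ge0.
have AeH : 0 <= A * e * H by rewrite !mulr_ge0 // (le_trans _ A2).
have prod_le : nrm (um - 'i%C * up) * nrm (um + 'i%C * up) <= q ^+ 2.
  rewrite sqr_sqrtr; last by rewrite divr_ge0 // ltW.
  rewrite ler_pdivlMr //; apply: le_trans W0; rewrite -mulrA mulrC.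
  by rewrite ler_wpM2r // mulr_ge0 // nrm_ge0.
(* [t] is ['i] or [- 'i], according to which factor is at most [q]; if both exceeded [q], so would
   their product exceed [q ^+ 2]. *)
have [t [t2 [nt ht]]] :
    exists t : C, t ^+ 2 = -1 /\ nrm t = 1 /\ nrm (um - t * up) <= q.
  have ni : nrm 'i%C = 1.
    by rewrite /Normc.normc /= expr0n /= add0r expr1n sqrtr1.
  have [h|h] := leP (nrm (um - 'i%C * up)) q.
    by exists 'i%C; rewrite sqr_i.
  exists (- 'i%C); rewrite sqrrN sqr_i nrmN mulNr opprK; split => //; split=> //.
  rewrite leNgt; apply/negP => h'.
  have := ltr_pM q0 q0 h h'; rewrite -expr2 => /lt_le_trans /(_ prod_le).
  by rewrite ltxx.
have w0 : size1 (y 0 - t *: x 0) <= 3 * q.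
  rewrite x0 y0 /size1 /=.
  (* By [t ^+ 2 = -1] the second coordinate is a multiple of the first, with a factor of norm at
     most 2; hence [3 * q] in total. *)
  have -> : - vm - t *: vp = - ((ac + rc * t) * (um - t * up)).
    rewrite hvm hvp /GRing.scale /=.
    have -> : (ac + rc * t) * (um - t * up) =
      ac * (um - t * up) + rc * t * um - rc * up * t ^+ 2 by ring.
    by rewrite t2; ring.
  rewrite nrmN nrmM.
  have h1 : nrm (ac + rc * t) <= 2.
    by apply: le_trans (nrmD _ _) _; rewrite nrmM nt; lra.
  have h2 := nrm_ge0 (um - t * up).
  rewrite -[t *: up]/(t * up).
  by have := ler_wpM2r h2 h1; lra.
have := size1_combination_le t n; set B := e * (1 + H) => hn.
have B0 : 0 <= B by rewrite mulr_ge0 // addr_ge0.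
have An : 0 <= A ^+ n by rewrite exprn_ge0 // (le_trans _ A2).
rewrite -{1}[(y n).1](subrK (t * (x n).1)) addrC.
rewrite (le_trans (nrmD _ _)) // nrmM nt mul1r lerD2l.
have : nrm ((y n).1 - t * (x n).1) <= size1 (y n - t *: x n) + B.
  by rewrite ler_wpDr // /size1 lerDl nrm_ge0.
move/le_trans; apply; rewrite (le_trans hn) // ler_wpM2l // lerD2r.
exact: w0.
Qed.

End Perturbed.
End Transfer.

(** * Generic phases: rotations, Baire category and the circle *)

Section Circle.
Variable R : realType.
Local Open Scope quotient_scope.

Lemma irrational_mul_neq (Phi : R) (m : nat) (p : int) :
  irrational Phi -> (0 < m)%N -> m%:R * Phi != p%:~R.
Proof.
move=> irr m0; apply/eqP => h; apply: irr; exists (p%:~R / m%:R) => //.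
rewrite fmorph_div /= ratr_int ratr_nat -h mulrC mulKf //.
by rewrite pnatr_eq0 -lt0n.
Qed.

(** Pigeonhole: among the fractional parts of [i * b] for [i <= n], two lie in the same one of [n]
    boxes of length [1 / n < e]. *)
Lemma dirichlet_approximation (b e : R) : 0 < e ->
  exists (q : nat) (p : int), (0 < q)%N /\ `|q%:R * b - p%:~R| < e.
Proof.
move=> e0; pose n := (Num.truncn e^-1).+1.
have ne : n%:R^-1 < e.
  by rewrite -[ltRHS]invrK ltf_pV2 ?posrE ?invr_gt0 // truncnS_gt.
pose fr (i : nat) : R := i%:R * b - (Num.floor (i%:R * b))%:~R.
have fr0 i : 0 <= fr i by rewrite subr_ge0 floor_le.
have fr1 i : fr i < 1.
  by rewrite ltrBlDl; have /andP[] := floor_itv (i%:R * b); rewrite intrD.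
have n0 : (0 : R) < n%:R by rewrite ltr0n.
pose t i := Num.truncn (n%:R * fr i).
have tP i : (t i)%:R <= n%:R * fr i < (t i).+1%:R.
  by apply: truncn_itv; rewrite mulr_ge0 // ltW.
have tn i : (t i < n)%N.
  rewrite -(ltr_nat R); have /andP[/le_lt_trans] := tP i; move=> -> //.
  by rewrite gtr_pMr.
pose f (i : 'I_n.+1) : 'I_n := Ordinal (tn i).
have /injectivePn[i [j ij fij]] : ~~ injectiveb f.
  apply/negP => /injectiveP /leq_card; rewrite !card_ord.
  by rewrite ltnn.
have {fij} tij : t i = t j by case: fij.
wlog lij : i j ij tij / (i < j)%N.
  move=> W; have [l|l|/val_inj eij] := ltngtP i j; first exact: (W i j).
    by apply: (W j i) => //; rewrite eq_sym.
  by rewrite eij eqxx in ij.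
exists (j - i)%N, (Num.floor (j%:R * b) - Num.floor (i%:R * b)).
split; first by rewrite subn_gt0.
apply: lt_trans ne.
have -> : (j - i)%:R * b -
    (Num.floor (j%:R * b) - Num.floor (i%:R * b))%:~R = fr j - fr i.
  by rewrite natrB ?(ltnW lij) // intrB /fr; ring.
rewrite -(ltr_pM2l n0) mulfV ?gt_eqF // -[X in X * _]gtr0_norm // -normrM mulrBr.
have /andP[] := tP i; have /andP[] := tP j; rewrite tij -natr1 ltr_norml.
by move: (n%:R * _) (n%:R * _) => x y *; apply/andP; split; lra.
Qed.

(** Dirichlet gives a nonzero step [g = q b - p] shorter than [e]. From [k b + t], steps of [g] walk
    towards an integer, and the last one before passing it lands within [|g|]. *)
Lemma irrational_rotation_dense (b t e : R) (k : nat) : 0 < e ->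
  (forall (q : nat) (p : int), (0 < q)%N -> q%:R * b != p%:~R) ->
  exists (j : nat) (p : int), (k <= j)%N /\ `|j%:R * b + t - p%:~R| < e.
Proof.
move=> e0 hb; have [q [p [q0 hqp]]] := dirichlet_approximation b e0.
set g := q%:R * b - p%:~R in hqp.
have g0 : g != 0 by rewrite subr_eq0 hb.
pose c := k%:R * b + t.
(* [m] is an integer on the side of [c] towards which steps of [g] move. *)
have [m hm] : exists m : int, 0 <= (m%:~R - c) / g.
  have [gp|gn] := ltP 0 g.
    exists (Num.floor c + 1); apply: divr_ge0; last exact: ltW.
    by rewrite subr_ge0 ltW //; have /andP[] := floor_itv c.
  exists (Num.floor c); rewrite ler_ndivlMr ?lt_neqAle ?g0 // mul0r subr_le0.
  by have /andP[] := floor_itv c.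
pose i := Num.truncn ((m%:~R - c) / g).
have /andP[h1 h2] : i%:R <= (m%:~R - c) / g < i.+1%:R by exact: truncn_itv.
exists (k + i * q)%N, (m + i%:Z * p); split; first exact: leq_addr.
apply: le_lt_trans hqp.
have -> : (k + i * q)%:R * b + t - (m + i%:Z * p)%:~R =
    g * (i%:R - (m%:~R - c) / g).
  by rewrite mulrBr mulrCA mulfV // mulr1 /g /c natrD natrM intrD intrM pmulrn; ring.
rewrite normrM ler_piMr // ler_norml; apply/andP; move: h2; rewrite -natr1.
by split; lra.
Qed.

Lemma open_circleE (O : set (circle R)) : open O = open (@circle_pi R @^-1` O).
Proof. by []. Qed.

Lemma circle_pi_eq (x y : R) : circle_pi x = circle_pi y -> x - y \is a Num.int.
Proof. by move=> /eqmodP. Qed.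

(* The phases [t] for which the potential is almost symmetric about [j s]:
   the tolerance 1 / j!^2 beats every exponential in [j]. *)
Definition near_symmetric (s : nat) (Phi : R) (j : nat) (t : R) : Prop :=
  exists p : int, `|2 * ((s * j)%:R * Phi + t) - p%:~R| < (j`!%:R^-1) ^+ 2.

(** Replacing [p] by [p + 2 m] absorbs an integer shift [m] of the phase, so the condition descends
    to the circle. *)
Lemma near_symmetric_int s Phi j (t t' : R) : t - t' \is a Num.int ->
  near_symmetric s Phi j t' -> near_symmetric s Phi j t.
Proof.
move=> /intrP [m tm] [p hp]; exists (p + 2 * m); rewrite intrD intrM -tm.
rewrite (_ : 2 * _ - _ = 2 * ((s * j)%:R * Phi + t') - p%:~R) //.
by ring.
Qed.

(** Each [U k] is open, and dense because [2 s Phi] is irrational. Baire's theorem on the line makes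
    the intersection dense, and periodicity carries it over to the circle. *)
Lemma generic_near_symmetric (s : nat) (Phi : R) : (0 < s)%N -> irrational Phi ->
  exists G : set (circle R), [/\ dense G, Gdelta G & forall t : R,
    G (circle_pi t) -> forall k, exists2 j, (k <= j)%N & near_symmetric s Phi j t].
Proof.
move=> s0 irr.
pose U k : set R := [set t | exists2 j, (k <= j)%N & near_symmetric s Phi j t].
pose O k : set (circle R) := @circle_pi R @` U k.
have UO k : @circle_pi R @^-1` (O k) = U k.
  apply/seteqP; split=> t; last by exists t.
  move=> [t' [j kj h] /esym /circle_pi_eq tt']; exists j => //.
  exact: near_symmetric_int h.
have oU k : open (U k).
  rewrite (_ : U k = \bigcup_(x in [set x : nat * int | (k <= x.1)%N])
    [set t | `|2 * ((s * x.1)%:R * Phi + t) - x.2%:~R| < (x.1`!%:R^-1) ^+ 2]).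
    apply: bigcup_open => -[j p] _ /=.
    apply: (@open_comp _ _ (fun t : R => `|2 * ((s * j)%:R * Phi + t) - p%:~R|)
      [set y | y < (j`!%:R^-1) ^+ 2]); last exact: open_lt.
    move=> t _; apply: cvg_norm.
    apply: cvgB; last exact: cvg_cst.
    apply: cvgM; first exact: cvg_cst.
    by apply: cvgD; [exact: cvg_cst | exact: cvg_id].
  apply/seteqP; split=> t; first by move=> [j kj [p hp]]; exists (j, p).
  by move=> [[j p] kj hp]; exists j => //; exists p.
have dU k : dense (U k).
  move=> V [t Vt] oV.
  have /nbhs_ballP [e /= e0 tV] : nbhs t V by exact: open_nbhs_nbhs.
  have hb (q : nat) (p : int) : (0 < q)%N -> q%:R * ((2 * s)%:R * Phi) != p%:~R.
    move=> q0; rewrite mulrA -natrM; apply: irrational_mul_neq => //.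
    by rewrite !muln_gt0 q0.
  have [j [p [kj hj]]] := irrational_rotation_dense (2 * t) k e0 hb.
  (* Moving the phase by half the defect makes the symmetry about [s j] exact. *)
  exists (t - (j%:R * ((2 * s)%:R * Phi) + 2 * t - p%:~R) / 2); split.
    apply: tV; rewrite /ball /= opprB addrC subrK normrM.
    rewrite [X in _ * X]ger0_norm ?invr_ge0 // ltr_pdivrMr //.
    by apply: lt_trans hj _; rewrite ltr_pMr // ltr1n.
  exists j => //; exists p.
  rewrite (_ : _ - _ = 0) ?normr0 ?exprn_gt0 ?invr_gt0 ?ltr0n ?fact_gt0 //.
  by rewrite !natrM; field.
exists (\bigcap_k O k); split.
- move=> V [c Vc] oV; rewrite open_circleE in oV.
  have := @Baire R R^o U (fun k => conj (oU k) (dU k)) _ _ oV.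
  case; first by exists (repr c); rewrite /= /circle_pi reprK.
  move=> t [Vt Ut]; exists (circle_pi t); split=> // k _.
  by have := Ut k I; rewrite -UO.
- by exists O => // k; rewrite open_circleE UO.
- move=> t Gt k; have := Gt k I.
  by change ((@circle_pi R @^-1` (O k)) t -> U k t); rewrite UO.
Qed.

End Circle.

(** * From the eigenvalue equation to a transfer recursion with positive [rho] *)

Section Eigen.
Variable R : realType.
Local Notation C := R[i].
Local Notation nrm := (@Normc.normc R).
Local Open Scope complex_scope.

(* In E u = z u with v = M u, the blocks of L (even sites) carry the spectral
   parameter z and those of M (odd sites) carry 1. *)
Definition zeta (z : C) (m : int) : C := if (2 %| m)%Z then z else 1.

Lemma int_parity (m : int) : exists n, m = 2 * n \/ m = 2 * n + 1.
Proof. by exists (m %/ 2)%Z; lia. Qed.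

Lemma even_dvdz (n : int) : (2 %| 2 * n)%Z.
Proof. by lia. Qed.

Lemma odd_dvdz (n : int) : (2 %| 2 * n + 1)%Z = false.
Proof. by lia. Qed.

Section Equation.
Variables (alpha rho u : int -> C) (z : C).
Hypothesis alpha_real : forall m, (alpha m)^*%R = alpha m.
Hypothesis adm : admissible alpha rho.
Hypothesis eigen : forall m, gecmv alpha rho u m = z * u m.

(* [v] is the image of [u] under M, so that E u = L v. *)
Let v m := if (2 %| m)%Z then (rho (m - 1))^*%R * u (m - 1) - alpha (m - 1) * u m
  else alpha m * u m + rho m * u (m + 1).

Let adm2 m : rho m * (rho m)^*%R = 1 - alpha m ^+ 2.
Proof.
have := adm m; rewrite !normCK alpha_real -expr2 => <-.
by rewrite addrAC subrr add0r.
Qed.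

Let v_odd n : v (2 * n + 1) =
  alpha (2 * n + 1) * u (2 * n + 1) + rho (2 * n + 1) * u (2 * n + 2).
Proof. by rewrite /v odd_dvdz -addrA. Qed.

Let v_even n : v (2 * n) =
  (rho (2 * n - 1))^*%R * u (2 * n - 1) - alpha (2 * n - 1) * u (2 * n).
Proof. by rewrite /v even_dvdz. Qed.

Let v_next n : v (2 * n + 2) =
  (rho (2 * n + 1))^*%R * u (2 * n + 1) - alpha (2 * n + 1) * u (2 * n + 2).
Proof.
have -> : 2 * n + 2 = 2 * (n + 1) by lia.
by rewrite v_even; have -> : 2 * (n + 1) - 1 = 2 * n + 1 by lia.
Qed.

Let eigen_even n : z * u (2 * n) =
  alpha (2 * n) * v (2 * n) + rho (2 * n) * v (2 * n + 1).
Proof.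
rewrite -eigen /gecmv even_dvdz; have -> : (2 * n %/ 2)%Z = n by lia.
by rewrite !alpha_real -v_even -v_odd.
Qed.

Let eigen_odd n : z * u (2 * n + 1) =
  (rho (2 * n))^*%R * v (2 * n) - alpha (2 * n) * v (2 * n + 1).
Proof.
rewrite -eigen /gecmv odd_dvdz; have -> : ((2 * n + 1) %/ 2)%Z = n by lia.
by rewrite !alpha_real -v_even -v_odd.
Qed.

(* E = L M with L and M direct sums of unitary 2x2 blocks, hence injective. *)
Lemma eigenvalue_neq0 : u != 0 -> z != 0.
Proof.
apply: contra => /eqP z0; apply/eqP.
(* For real [alpha] the 2x2 blocks of L and M are their own inverses: [L v = 0] forces [v = 0], and
   then [M u = 0] forces [u = 0]. *)
have ve n : v (2 * n) = 0.
  have := adm2 (2 * n); have := eigen_even n; have := eigen_odd n.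
  rewrite z0 !mul0r => ho he ha.
  have -> : v (2 * n) = (alpha (2 * n) ^+ 2 + rho (2 * n) * (rho (2 * n))^*%R) *
    v (2 * n) by rewrite ha; ring.
  transitivity (alpha (2 * n) *
      (alpha (2 * n) * v (2 * n) + rho (2 * n) * v (2 * n + 1)) +
    rho (2 * n) *
      ((rho (2 * n))^*%R * v (2 * n) - alpha (2 * n) * v (2 * n + 1))).
    by ring.
  by rewrite -he -ho !mulr0 addr0.
have vo n : v (2 * n + 1) = 0.
  have := adm2 (2 * n); have := eigen_even n; have := eigen_odd n.
  rewrite z0 !mul0r => ho he ha.
  have -> : v (2 * n + 1) = (alpha (2 * n) ^+ 2 + rho (2 * n) * (rho (2 * n))^*%R) *
    v (2 * n + 1) by rewrite ha; ring.
  transitivity ((rho (2 * n))^*%R *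
      (alpha (2 * n) * v (2 * n) + rho (2 * n) * v (2 * n + 1)) -
    alpha (2 * n) *
      ((rho (2 * n))^*%R * v (2 * n) - alpha (2 * n) * v (2 * n + 1))).
    by ring.
  by rewrite -he -ho !mulr0 subr0.
have uo n : u (2 * n + 1) = 0.
  have := adm2 (2 * n + 1); have := v_odd n; have := v_next n.
  have -> : 2 * n + 2 = 2 * (n + 1) by lia.
  rewrite ve vo => ho he ha.
  have -> : u (2 * n + 1) = (alpha (2 * n + 1) ^+ 2 +
    rho (2 * n + 1) * (rho (2 * n + 1))^*%R) * u (2 * n + 1) by rewrite ha; ring.
  transitivity (alpha (2 * n + 1) * (alpha (2 * n + 1) * u (2 * n + 1) +
      rho (2 * n + 1) * u (2 * (n + 1))) +
    rho (2 * n + 1) * ((rho (2 * n + 1))^*%R * u (2 * n + 1) -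
      alpha (2 * n + 1) * u (2 * (n + 1)))).
    by ring.
  by rewrite -he -ho !mulr0 addr0.
have ue n : u (2 * n + 2) = 0.
  have := adm2 (2 * n + 1); have := v_odd n; have := v_next n.
  rewrite vo (_ : v (2 * n + 2) = 0); last first.
    by have -> : 2 * n + 2 = 2 * (n + 1) by lia.
  rewrite uo !mulr0 !add0r => /esym/eqP; rewrite oppr_eq0 mulf_eq0 => h.
  move=> /esym/eqP; rewrite mulf_eq0 => h' ha.
  case/orP: h => /eqP // a0; case/orP: h' => /eqP // r0.
  by move: ha; rewrite a0 r0 mul0r expr0n subr0 => /esym/eqP; rewrite oner_eq0.
apply/funext => m /=; have [n [->|->]] := int_parity m; last exact: uo.
by have := ue (n - 1); have -> : 2 * (n - 1) + 2 = 2 * n by lia.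
Qed.

Hypothesis rho_neq0 : forall m, rho m != 0.
Hypothesis z_neq0 : z != 0.

(** Each value of [w = M u] combines two neighbouring values of [u], with coefficients of norm at
    most 1. The resulting bound serves to make the pair square summable. *)
Lemma eigen_transfer : exists w : int -> C,
  (forall m, (u (m + 1), w (m + 1)) =
    transfer (zeta z m) (alpha m) (rho m) (u m, w m)) /\
  (forall m, nrm (rho m) <= 1 -> nrm (rho (m - 1)) <= 1 ->
    nrm (alpha m) <= 1 -> nrm (alpha (m - 1)) <= 1 ->
    nrm (w m) <= nrm (u (m - 1)) + nrm (u m) + nrm (u (m + 1))).
Proof.
exists v; split=> [m|m rm rm1 am am1].
  have [n [->|->]] := int_parity m; rewrite /transfer /zeta /=.
    rewrite even_dvdz; have r0 := rho_neq0 (2 * n); have ha := adm2 (2 * n).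
    have he := eigen_even n; have ho := eigen_odd n.
    congr pair; last first.
      apply: (mulfI r0); rewrite he; field.
      by rewrite r0.
    apply: (mulfI z_neq0); rewrite ho; apply: (mulfI r0).
    have -> : rho (2 * n) * (z * ((z^-1 * v (2 * n) - alpha (2 * n) * u (2 * n)) /
       rho (2 * n))) = v (2 * n) - alpha (2 * n) * (z * u (2 * n)).
      by field; rewrite r0 z_neq0.
    by rewrite he mulrBr mulrA ha; ring.
  rewrite odd_dvdz -addrA -[1 + 1]/2 invr1 !mul1r.
  have r0 := rho_neq0 (2 * n + 1); have ha := adm2 (2 * n + 1).
  rewrite v_next v_odd; congr pair; apply: (mulfI r0).
    by field.
  rewrite mulrBr mulrA ha; field.
  by rewrite r0.
rewrite /v; case: ifP => _.
  apply: le_trans (nrmB _ _) _; rewrite !nrmM.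
  have -> : nrm (rho (m - 1))^*%R = nrm (rho (m - 1)).
    by apply: complexI; rewrite -!normE norm_conjC.
  have h1 := ler_wpM2r (nrm_ge0 (u (m - 1))) rm1.
  have h2 := ler_wpM2r (nrm_ge0 (u m)) am1.
  by have := nrm_ge0 (u (m + 1)); lra.
apply: le_trans (nrmD _ _) _; rewrite !nrmM.
have h1 := ler_wpM2r (nrm_ge0 (u (m + 1))) rm.
have h2 := ler_wpM2r (nrm_ge0 (u m)) am.
by have := nrm_ge0 (u (m - 1)); lra.
Qed.

End Equation.

(** Products forward from [d 0 = 1], inverse products backward. This supplies the phases of the
    gauge transformation. *)
Lemma multiplicative_antiderivative (c : int -> C) : (forall m, nrm (c m) = 1) ->
  exists d : int -> C, (forall m, nrm (d m) = 1) /\ forall m, d (m + 1) = d m * c m.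
Proof.
move=> c1.
have c0 m : c m != 0 by rewrite -nrm_eq0 c1 oner_neq0.
pose d (m : int) := match m with
  | Posz n => \prod_(i < n) c i%:Z
  | Negz n => (\prod_(i < n.+1) c (Negz i))^-1 end.
have prod1 n (f : nat -> int) : nrm (\prod_(i < n) c (f i)) = 1.
  elim: n => [|n ih]; first by rewrite big_ord0 Normc.normc1.
  by rewrite big_ord_recr nrmM ih c1 mulr1.
exists d; split=> [[n|n]|[n|n]] /=; first exact: prod1.
- by rewrite Normc.normcV prod1 invr1.
- by rewrite addn1 big_ord_recr.
case: n => [|n].
  by rewrite /= big_ord0 big_ord1 mulVf.
have -> : Negz n.+1 + 1 = Negz n by lia.
rewrite /d [in RHS]big_ord_recr /= invfM mulfVK //.
Qed.

(** Divide both sequences by phases with [d (m + 1) / d m = |rho m| / rho m]. The phases of [rho]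
    may be asymmetric, whereas [|rho|] is determined by [alpha] and inherits its near symmetry. *)
Lemma gauge (alpha : int -> C) (rho u v : int -> C) (z : C) :
  (forall m, rho m != 0) ->
  (forall m, (u (m + 1), v (m + 1)) =
    transfer (zeta z m) (alpha m) (rho m) (u m, v m)) ->
  exists u' v' : int -> C,
    [/\ forall m, nrm (u' m) = nrm (u m), forall m, nrm (v' m) = nrm (v m) &
    forall m, (u' (m + 1), v' (m + 1)) =
      transfer (zeta z m) (alpha m) (nrm (rho m))%:C (u' m, v' m)].
Proof.
move=> r0 h.
have [|d [d1 hd]] := @multiplicative_antiderivative
    (fun m => (nrm (rho m))%:C / rho m) _.
  move=> m; rewrite nrmM Normc.normcV nrm_real ger0_norm ?nrm_ge0 //.
  by rewrite mulfV // nrm_eq0.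
have d0 m : d m != 0 by rewrite -nrm_eq0 d1 oner_neq0.
have n0 m : (nrm (rho m))%:C != 0 :> C by rewrite -normE normr_eq0.
exists (fun m => u m / d m), (fun m => v m / d m); split=> m.
- by rewrite nrmM Normc.normcV d1 invr1 mulr1.
- by rewrite nrmM Normc.normcV d1 invr1 mulr1.
have := h m; rewrite /transfer /= => -[-> ->]; rewrite hd.
have := d0 m; have := n0 m; have := r0 m.
move: ((nrm (rho m))%:C : C) (d m) (rho m) (u m) (v m) (zeta z m) (alpha m).
move=> n x y a b zz al y0 n0' x0; congr pair.
  by move: (zz^-1) => zi; field; rewrite x0 y0 n0'.
by field; rewrite x0 y0 n0'.
Qed.

End Eigen.

(** * Reflecting a solution about a centre *)

Section Reflection.
Variable R : realType.
Local Notation C := R[i].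
Local Notation nrm := (@Normc.normc R).
Local Open Scope complex_scope.

(** With T the transfer matrix and S = diag(1, -1), one has [S T S = - T^-1], hence [T S T = - S]:
    up to signs, the recursion run backwards is the recursion run forwards. *)
Lemma transfer_reflect (z a r t : C) (p p' : C * C) : z != 0 -> r != 0 ->
  r ^+ 2 = 1 - a ^+ 2 -> p' = transfer z a r p ->
  transfer z a r (t * p'.1, - (t * p'.2)) = (- t * p.1, t * p.2).
Proof.
case: p => x y z0 r0 ra ->; rewrite /transfer /=; congr pair.
  apply: (mulfI r0); apply: (mulfI r0).
  have -> : r * (r * (- t * x)) = r ^+ 2 * (- t * x) by ring.
  by rewrite ra; field; rewrite z0 r0.
apply: (mulfI r0); apply: (mulfI r0).
have -> : r * (r * (t * y)) = r ^+ 2 * (t * y) by ring.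
by rewrite ra; field; rewrite z0 r0.
Qed.

(** The matrix entries are [a / r] up to sign, and [1 / r] times [z] or [z^-1]; hence the two
    quantities compared. *)
Lemma transfer_perturb (z : C) (a r a' r' Z d : R) (p : C * C) :
  0 <= d -> nrm z <= Z -> nrm z^-1 <= Z ->
  `|r'^-1 - r^-1| <= d -> `|a' / r' - a / r| <= d ->
  size1 (transfer z a'%:C r'%:C p - transfer z a%:C r%:C p) <= (Z + 1) * d * size1 p.
Proof.
case: p => x y d0 hz hzi hr ha; rewrite /transfer /size1 /=.
set dr : C := (r'^-1 - r^-1)%:C; set da : C := (a' / r' - a / r)%:C.
have hdr : nrm dr <= d by rewrite nrm_real.
have hda : nrm da <= d by rewrite nrm_real.
have e1 (w q s : C) : (w * q - a'%:C * s) / r'%:C - (w * q - a%:C * s) / r%:C =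
    w * q * dr - da * s.
  by rewrite /dr /da !rmorphB /= !rmorphM /= !fmorphV; ring.
rewrite !e1; have n0 := @nrm_ge0 R.
have bd (w q s : C) : nrm w <= Z ->
    nrm (w * q * dr - da * s) <= Z * d * nrm q + d * nrm s.
  move=> hw; apply: le_trans (nrmB _ _) _; rewrite !nrmM.
  apply: lerD; last by rewrite ler_wpM2r.
  by rewrite mulrAC ler_wpM2r // ler_pM.
have := bd z^-1 y x hzi; have := bd z x y hz.
have -> : (Z + 1) * d * (nrm x + nrm y) = Z * d * nrm y + d * nrm x +
  (Z * d * nrm x + d * nrm y) by ring.
by move=> h1 h2; rewrite lerD.
Qed.

(** The site reflection [m -> 4 n - 1 - m] sends the step from [m] to [m + 1] to the step at
    [4 n - 2 - m]. This keeps parity and fixes the odd step [2 n - 1]. *)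
Lemma zeta_reflect (z : C) (n : nat) (m : int) :
  zeta z (4 * n%:Z - 2 - m) = zeta z m.
Proof. by rewrite /zeta; congr (if _ then _ else _); lia. Qed.

Section Decay.
Variables (u v : int -> C) (z : C) (a r : int -> R) (k Z H d : R) (N : nat).
Hypothesis k0 : 0 < k.
Hypothesis k1 : k <= 1.
Hypothesis Z1 : 1 <= Z.
Hypothesis hz : nrm z <= Z.
Hypothesis hzi : nrm z^-1 <= Z.
Hypothesis z0 : z != 0.
Hypothesis kr : forall m, k <= r m.
Hypothesis ra : forall m, r m ^+ 2 = 1 - a m ^+ 2.
Hypothesis Huv : forall (m : int) (n : nat),
  \sum_(j < n) size1 (u (m + j%:Z), v (m + j%:Z)) ^+ 2 <= H.
Hypothesis huv : forall m, (u (m + 1), v (m + 1)) =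
  transfer (zeta z m) (a m)%:C (r m)%:C (u m, v m).
Hypothesis d0 : 0 <= d.
Hypothesis sym_r : forall m, `|(r (4 * N%:Z - 2 - m))^-1 - (r m)^-1| <= d.
Hypothesis sym_a : forall m,
  `|a (4 * N%:Z - 2 - m) / r (4 * N%:Z - 2 - m) - a m / r m| <= d.

Lemma reflected_decay (i : nat) (A e : R) :
  A = (Z + 1) / k -> e = (Z + 1) * d ->
  nrm (u (2 * N%:Z - 1 - i%:Z)) <= nrm (u (2 * N%:Z + i%:Z)) +
    A ^+ i * (3 * Num.sqrt (A * e * H / k) + e * (1 + H)).
Proof.
move=> AE eE.
have rpos m : 0 < r m by exact: lt_le_trans (kr m).
have rC0 m : (r m)%:C != 0 :> C by rewrite -nrm_eq0 nrm_real normr_eq0 gt_eqF.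
have raC m : (r m)%:C ^+ 2 = 1 - (a m)%:C ^+ 2 :> C.
  by rewrite -!rmorphXn -[1]/(1%:C) -rmorphB ra.
have na m : nrm (a m)%:C <= 1.
  rewrite nrm_real -(@expr_le1 _ 2) // real_normK ?num_real //.
  by have := sqr_ge0 (r m); rewrite ra subr_ge0.
have nr m : nrm (r m)%:C <= 1.
  rewrite nrm_real -(@expr_le1 _ 2) // real_normK ?num_real //.
  by rewrite ra gerBl sqr_ge0.
have knr m : k <= nrm (r m)%:C by rewrite nrm_real gtr0_norm.
have zt m : [/\ zeta z m != 0, nrm (zeta z m) <= Z & nrm (zeta z m)^-1 <= Z].
  by rewrite /zeta; case: ifP; split; rewrite ?invr1 ?Normc.normc1 ?oner_neq0.
have A2 : 2 <= A.
  rewrite AE ler_pdivlMr // mulr_natl mulr2n addrC.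
  by rewrite lerD // (le_trans k1).
have e0 : 0 <= e by rewrite eE mulr_ge0 // addr_ge0 // (le_trans _ Z1).
pose x (j : nat) := (u (2 * N%:Z + j%:Z), v (2 * N%:Z + j%:Z)).
(* The signs are those of [transfer_reflect]: [y] solves exactly the recursion with reflected
   coefficients, hence almost solves that of [x]. *)
pose y (j : nat) := ((-1) ^+ j * u (2 * N%:Z - 1 - j%:Z),
  - ((-1) ^+ j * v (2 * N%:Z - 1 - j%:Z))).
have nsgn j : nrm ((-1) ^+ j) = 1.
  elim: j => [|j ih]; first by rewrite expr0 Normc.normc1.
  by rewrite exprS nrmM ih mulr1 nrmN Normc.normc1.
have sz_y j : size1 (y j) =
    size1 (u (2 * N%:Z - 1 - j%:Z), v (2 * N%:Z - 1 - j%:Z)).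
  by rewrite /size1 /y /= nrmN !nrmM nsgn !mul1r.
pose m (j : nat) := 2 * N%:Z + j%:Z.
have step_x j : x j.+1 = transfer (zeta z (m j)) (a (m j))%:C (r (m j))%:C (x j).
  rewrite /x -[X in (u X, v X)]/(2 * N%:Z + j.+1%:Z).
  have -> : 2 * N%:Z + j.+1%:Z = m j + 1 by rewrite /m (intS j) [1 + _]addrC addrA.
  exact: huv.
have step_y j : y j.+1 = transfer (zeta z (m j)) (a (4 * N%:Z - 2 - m j))%:C
    (r (4 * N%:Z - 2 - m j))%:C (y j).
  set m' := 4 * N%:Z - 2 - m j.
  have -> : zeta z (m j) = zeta z m'.
    by rewrite /m' zeta_reflect.
  have [zt0 _ _] := zt m'.
  have := transfer_reflect ((-1) ^+ j) zt0 (rC0 m') (raC m') (huv m') => /=.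
  have -> : m' + 1 = 2 * N%:Z - 1 - j%:Z by rewrite /m' /m; ring.
  move=> ->; rewrite /y exprS.
  have -> : 2 * N%:Z - 1 - j.+1%:Z = m' by rewrite /m' /m (intS j); ring.
  by rewrite !mulN1r !mulNr opprK.
have hyp j : size1 (y j.+1 - transfer (zeta z (m j)) (a (m j))%:C (r (m j))%:C (y j))
    <= e * size1 (y j).
  rewrite eE step_y; have [_ h1 h2] := zt (m j).
  exact: transfer_perturb.
have Hy n : \sum_(j < n) size1 (y j) ^+ 2 <= H.
  rewrite (reindex_inj rev_ord_inj) /=; apply: le_trans (Huv (2 * N%:Z - n%:Z) n).
  apply: ler_sum => j _; rewrite sz_y.
  have -> : 2 * N%:Z - 1 - (n - j.+1)%N%:Z = 2 * N%:Z - n%:Z + j%:Z.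
    by rewrite -subzn ?ltn_ord // (intS j); ring.
  by [].
have sgn_y j : nrm (y j).1 = nrm (u (2 * N%:Z - 1 - j%:Z)).
  by rewrite /y /= nrmM nsgn mul1r.
rewrite -sgn_y -[nrm (u (_ + _))]/(nrm (x i).1).
set mc := 2 * N%:Z - 1.
have mc1 : mc + 1 = m 0 by rewrite /mc /m subrK addr0.
(* The central step is at an odd site, so the central values satisfy the relations of a real block
   of M, as [reflection_bound] requires. *)
have zmc : zeta z mc = 1.
  have -> : mc = 2 * (N%:Z - 1) + 1 by rewrite /mc; ring.
  by rewrite /zeta odd_dvdz.
have := huv mc; rewrite mc1 zmc /transfer /= invr1 !mul1r => -[hu hv].
have rmc := rC0 mc; have ramc := raC mc.
have hvm : v mc = (a mc)%:C * u mc + (r mc)%:C * u (m 0).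
  by rewrite hu [X in _ + X]mulrC mulfVK // addrC subrK.
have hvp : v (m 0) = (r mc)%:C * u mc - (a mc)%:C * u (m 0).
  apply: (mulfI rmc); rewrite mulrBr mulrA -expr2 ramc hv [LHS]mulrC mulfVK // hvm.
  by ring.
apply: (@reflection_bound R x y (zeta z \o m) (fun j => (a (m j))%:C)
  (fun j => (r (m j))%:C) A e H _ _ _ A2 _ _ e0 hyp _ Hy
  (u mc) (v mc) (u (m 0)) (v (m 0)) (a mc)%:C (r mc)%:C k i) => //.
- by move=> j; have [] := zt (m j).
- by move=> j p; rewrite AE; have [_ h1 h2] := zt (m j); exact: transfer_le.
- by move=> n; exact: Huv.
- by rewrite /y expr0 !mul1r subr0.
Qed.

End Decay.
End Reflection.

(** * Square summability on windows of sites *)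

Section Main.
Variable R : realType.
Local Notation C := R[i].
Local Notation nrm := (@Normc.normc R).
Local Open Scope complex_scope.

(** The bound is uniform in the starting point [m] because the centres move off to infinity. *)
Lemma l2_sum_le (u : int -> C) : l2 u ->
  exists K : R, forall (m : int) n, \sum_(j < n) nrm (u (m + j%:Z)) ^+ 2 <= K.
Proof.
rewrite /l2 /= summableE => /fineK fE.
exists (fine (\esum_(x in [set: int]) `|(nrm (u x) ^+ 2)%:E|)%E) => m n.
rewrite -lee_fin fE; apply: esum_ge.
pose s := [seq m + j%:Z | j <- iota 0 n].
exists [set` s]; first by split=> //; exact: finite_seq.
rewrite -fsbig_seq; last first.
  by rewrite map_inj_uniq ?iota_uniq // => i j /addrI [].
rewrite big_map -[X in iota 0 X]subn0 -/(index_iota 0 n) big_mkord sumEFin.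
by rewrite lee_fin; apply: ler_sum => i _; rewrite ger0_norm ?sqr_ge0.
Qed.

Lemma bounded_series_cvg0 (f : nat -> R) (K : R) : (forall j, 0 <= f j) ->
  (forall n, \sum_(j < n) f j <= K) -> f @ \oo --> 0.
Proof.
move=> f0 fK; apply: cvg_series_cvg_0; apply: nondecreasing_is_cvgn.
  by apply: nondecreasing_series => n _ _; exact: f0.
by exists K => _ [n _ <-]; rewrite /series /= big_mkord.
Qed.

Lemma l2_cvg0 (u : int -> C) (K d : R) (m : int) : 0 < d ->
  (forall (m : int) n, \sum_(j < n) nrm (u (m + j%:Z)) ^+ 2 <= K) ->
  \forall j \near \oo, nrm (u (m + j%:Z)) < d.
Proof.
move=> d0 uK; have := @bounded_series_cvg0 (fun j => nrm (u (m + j%:Z)) ^+ 2) K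
  (fun j => sqr_ge0 _) (uK m).
move=> /cvgr0_norm_lt /(_ (d ^+ 2)) H; have /H : 0 < d ^+ 2 by rewrite exprn_gt0.
apply: filterS => j; rewrite ger0_norm ?sqr_ge0 // ltr_sqr ?nnegrE ?nrm_ge0 //.
exact: ltW.
Qed.

Lemma sum_neighbours_le (u v : int -> C) (K : R) :
  (forall (m : int) n, \sum_(j < n) nrm (u (m + j%:Z)) ^+ 2 <= K) ->
  (forall m, nrm (v m) <= nrm (u (m - 1)) + nrm (u m) + nrm (u (m + 1))) ->
  forall (m : int) n,
    \sum_(j < n) size1 (u (m + j%:Z), v (m + j%:Z)) ^+ 2 <= 12 * (K + K + K).
Proof.
move=> uK vu m n.
have h : \sum_(j < n) (nrm (u (m - 1 + j%:Z)) ^+ 2 + nrm (u (m + j%:Z)) ^+ 2 +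
    nrm (u (m + 1 + j%:Z)) ^+ 2) <= K + K + K.
  rewrite !big_split /=; apply: lerD; last exact: uK.
  by apply: lerD; exact: uK.
apply: le_trans (ler_wpM2l _ h) => //; rewrite mulr_sumr; apply: ler_sum => j _.
have := vu (m + j%:Z); rewrite /size1 /= ![m + j%:Z + _]addrAC.
move: (nrm_ge0 (u (m - 1 + j%:Z))) (nrm_ge0 (u (m + j%:Z))) (nrm_ge0 (v (m + j%:Z))).
move: (nrm_ge0 (u (m + 1 + j%:Z)));
move: (nrm (u (m - 1 + j))) (nrm (u (m + j))) (nrm (v (m + j))).
move=> x y w; move: (nrm _) => t t0 x0 y0 w0 hw.
(* The constant is [12 = 4 * 3], with 3 from [(x + y + t)^2 <= 3 (x^2 + y^2 + t^2)]. *)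
have h1 : (y + w) ^+ 2 <= (2 * (x + y + t)) ^+ 2.
  rewrite lerXn2r ?nnegrE ?mulr_ge0 ?addr_ge0 //; lra.
apply: le_trans h1 _.
have := sqr_ge0 (x - y); have := sqr_ge0 (x - t); have := sqr_ge0 (y - t).
lra.
Qed.

(** * Near symmetry and size of the mosaic coefficients *)

Lemma cos_lipschitz (x y : R) : `|cos x - cos y| <= `|x - y|.
Proof.
wlog xy : x y / y < x.
  move=> W; have [h|h|->] := ltgtP x y; last by rewrite !subrr.
    by rewrite distrC [leRHS]distrC; exact: W.
  exact: W.
have dcos t : t \in `]y, x[%R -> is_derive t 1 (@cos R) (- sin t).
  by move=> _; exact: is_derive_cos.
have ccos : {within `[y, x], continuous (@cos R)}.
  by apply: continuous_subspaceT => t; exact: continuous_cos.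
have [c _ ->] := MVT xy dcos ccos.
by rewrite normrM ler_piMl // normrN sin_max.
Qed.

Lemma cos_int_period (x : R) (p : int) : cos (x + 2 * pi * p%:~R) = cos x.
Proof.
have hn (n : nat) t : cos (t + 2 * pi * n%:R) = cos t :> R.
  elim: n => [|n ih]; first by rewrite mulr0 addr0.
  rewrite -[n.+1%:R]natr1 mulrDr mulr1 addrA.
  by rewrite [X in _ + X]mulr_natl cosD2pi.
case: p => n; first by rewrite -pmulrn hn.
by rewrite NegzE mulrNz mulrN -(hn n.+1 (x - _)) subrK.
Qed.

Lemma cos_reflect_le (x y D : R) (p : int) :
  y = D - x + p%:~R -> `|cos (2 * pi * y) - cos (2 * pi * x)| <= 2 * pi * `|D|.
Proof.
move=> ->; rewrite mulrDr cos_int_period -(cosN (_ * x)).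
apply: le_trans (cos_lipschitz _ _) _; rewrite opprK mulrBr subrK normrM.
by rewrite (@ger0_norm _ (2 * pi)) // mulr_ge0 ?pi_ge0.
Qed.

Definition mosaic_coef (s : nat) (lambda1 lambda2 Phi theta : R) (m : int) : R :=
  if (2 %| m)%Z then Num.sqrt (1 - lambda1 ^+ 2)
  else let n := ((m + 1) %/ 2)%Z in
    if (s %| n)%Z then lambda2 * cos (2 * pi * (n%:~R * Phi + theta)) else 0.

Lemma mosaic_alphaE s lambda1 lambda2 Phi theta m :
  mosaic_alpha s lambda1 lambda2 Phi theta m =
  (mosaic_coef s lambda1 lambda2 Phi theta m)%:C.
Proof.
rewrite /mosaic_alpha /mosaic_coef /=; case: ifP => // _.
by case: ifP.
Qed.

(** Even sites carry a constant. At odd sites [n -> 2 s j - n] preserves divisibility by [s], so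
    zeros match zeros and cosines match cosines; evenness and periodicity of the cosine leave only
    the defect [D]. *)
Lemma mosaic_reflect s lambda1 lambda2 Phi theta j (D : R) (p : int) (m : int) :
  0 < lambda2 < 1 -> D = 2 * ((s * j)%:R * Phi + theta) - p%:~R ->
  `|mosaic_coef s lambda1 lambda2 Phi theta (4 * (s * j)%N%:Z - 2 - m) -
    mosaic_coef s lambda1 lambda2 Phi theta m| <= 2 * pi * `|D|.
Proof.
move=> /andP[l0 l1] DE; rewrite /mosaic_coef.
have D0 : 0 <= 2 * pi * `|D| :> R by rewrite !mulr_ge0 ?pi_ge0.
set N := (s * j)%N.
have -> : (2 %| 4 * N%:Z - 2 - m)%Z = (2 %| m)%Z by lia.
case: ifP => [_|hm]; first by rewrite subrr normr0.
have -> : ((4 * N%:Z - 2 - m + 1) %/ 2)%Z = 2 * N%:Z - ((m + 1) %/ 2)%Z by lia.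
set n := ((m + 1) %/ 2)%Z.
have sN : (s %| 2 * N%:Z)%Z by rewrite /N PoszM mulrCA dvdz_mulr.
rewrite /= (_ : (s %| 2 * N%:Z - n)%Z = (s %| n)%Z); last first.
  exact: rpredBl.
case: ifP => _; last by rewrite subrr normr0.
rewrite -mulrBr normrM (gtr0_norm l0).
have : `|cos (2 * pi * ((2 * N%:Z - n)%:~R * Phi + theta)) -
    cos (2 * pi * (n%:~R * Phi + theta))| <= 2 * pi * `|D|.
  apply: (@cos_reflect_le _ _ D p); rewrite DE -/N.
  have -> : (2 * N%:Z - n)%:~R = 2 * N%:R - n%:~R :> R by rewrite intrB intrM.
  by move: (N%:R : R) => w; ring.
by apply: le_trans; rewrite ler_piMl // ltW.
Qed.

(** The right side is [lambda1^2] at even sites and at least [1 - lambda2^2] at odd ones; the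
    product lies below both. This keeps [|rho|] away from 0 uniformly. *)
Lemma mosaic_coef_le s lambda1 lambda2 Phi theta m :
  0 < lambda1 < 1 -> 0 < lambda2 < 1 ->
  (lambda1 * Num.sqrt (1 - lambda2 ^+ 2)) ^+ 2 <=
    1 - mosaic_coef s lambda1 lambda2 Phi theta m ^+ 2.
Proof.
move=> /andP[a0 a1] /andP[b0 b1].
have a2 : lambda1 ^+ 2 <= 1 by rewrite expr_le1 // ltW.
have b2 : lambda2 ^+ 2 <= 1 by rewrite expr_le1 // ltW.
have a3 := sqr_ge0 lambda1; have b3 := sqr_ge0 lambda2.
rewrite exprMn sqr_sqrtr ?subr_ge0 // /mosaic_coef.
case: ifP => _.
  by rewrite sqr_sqrtr ?subr_ge0 // subKr ler_piMr // gerBl.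
have hb : lambda1 ^+ 2 * (1 - lambda2 ^+ 2) <= 1 - lambda2 ^+ 2.
  by rewrite ler_piMl // subr_ge0.
case: ifP => _ /=.
  by apply: le_trans hb _; rewrite lerD2l lerN2 exprMn ler_piMr ?sqr_ge0.
by rewrite expr0n subr0 (le_trans hb) // gerBl.
Qed.

(** From [(r - r') (r + r') = (a' - a) (a' + a)] and [r + r' >= 2 k] follows [|r - r'| <= d / k];
    inverting [r] and [r'] costs two more factors [1 / k]. *)
Lemma quotient_perturb (k a r a' r' d : R) : 0 < k -> k <= 1 ->
  k <= r -> k <= r' -> r ^+ 2 = 1 - a ^+ 2 -> r' ^+ 2 = 1 - a' ^+ 2 ->
  `|a' - a| <= d ->
  `|r'^-1 - r^-1| <= 2 * d / k ^+ 3 /\ `|a' / r' - a / r| <= 2 * d / k ^+ 3.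
Proof.
move=> k0 k1 kr kr' ra ra' hd.
have r0 : 0 < r by lra.
have r'0 : 0 < r' by lra.
have d0 : 0 <= d by apply: le_trans hd.
have le1 (x y : R) : y ^+ 2 = 1 - x ^+ 2 -> `|x| <= 1.
  move=> h; rewrite -(@expr_le1 _ 2) // real_normK ?num_real //.
  by have := sqr_ge0 y; rewrite h subr_ge0.
have na := le1 _ _ ra; have na' := le1 _ _ ra'.
have hr : `|r - r'| <= d / k.
  have e : (r - r') * (r + r') = (a' - a) * (a' + a).
    transitivity (r ^+ 2 - r' ^+ 2); first by ring.
    by rewrite ra ra'; ring.
  have : `|r - r'| * (r + r') <= d * 2.
    rewrite -[X in _ * X]gtr0_norm ?addr_gt0 // -normrM e normrM ler_pM //.
    by apply: le_trans (ler_normD _ _) _; lra.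
  rewrite ler_pdivlMr //; have := normr_ge0 (r - r') => n0.
  have : `|r - r'| * (2 * k) <= `|r - r'| * (r + r').
    by rewrite ler_wpM2l //; lra.
  lra.
have ik : (k ^+ 3)^-1 = k^-1 * k^-1 * k^-1 by rewrite -exprVn !exprS expr0 mulr1 mulrA.
have ik0 : 0 < k^-1 by rewrite invr_gt0.
have ik1 : 1 <= k^-1 by rewrite invf_ge1.
have ir : r^-1 <= k^-1 by rewrite lef_pV2.
have ir' : r'^-1 <= k^-1 by rewrite lef_pV2.
have ir0 : 0 < r^-1 by rewrite invr_gt0.
have ir'0 : 0 < r'^-1 by rewrite invr_gt0.
have h1 : `|r'^-1 - r^-1| <= d / k ^+ 3.
  have -> : r'^-1 - r^-1 = (r - r') * (r'^-1 * r^-1).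
    by field; rewrite !gt_eqF.
  have -> : d / k ^+ 3 = d / k * (k^-1 * k^-1) by rewrite ik; ring.
  rewrite normrM (gtr0_norm (mulr_gt0 ir'0 ir0)).
  apply: ler_pM => //; first by rewrite mulr_ge0 // ltW.
  by apply: ler_pM => //; exact: ltW.
have dk0 : 0 <= d / k ^+ 3 by rewrite divr_ge0 // exprn_ge0 // ltW.
have dk : d / k <= d / k ^+ 3.
  rewrite ler_wpM2l // ik -mulrA ler_peMr //; first exact: ltW.
  by rewrite -[1]mulr1 ler_pM.
have e2 : 2 * d / k ^+ 3 = d / k ^+ 3 + d / k ^+ 3 by rewrite -mulrA; ring.
split; first by rewrite e2 ler_wpDr.
have -> : a' / r' - a / r = (a' - a) / r' + a * (r'^-1 - r^-1) by ring.
apply: le_trans (ler_normD _ _) _; rewrite e2 !normrM (gtr0_norm ir'0).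
apply: lerD; last by apply: le_trans h1; rewrite ler_piMl.
by apply: le_trans dk; rewrite ler_pM // ltW.
Qed.

End Main.

(** * Absence of eigenvectors at near-symmetric phases *)

Section Absence.
Variable R : realType.
Local Notation C := R[i].
Local Notation nrm := (@Normc.normc R).
Local Open Scope complex_scope.

Lemma exp_div_fact_small (x B d : R) : 0 <= B -> 0 < d ->
  \forall j \near \oo, B * (x ^+ j * j`!%:R^-1) < d.
Proof.
(* Dividing by [B + 1] covers [B = 0]. *)
move=> B0 d0; have d1 : 0 < d / (B + 1) by rewrite divr_gt0 // ltr_wpDl.
have /cvgr0_norm_lt /(_ _ d1) := @cvg_exp_coeff R x.
apply: filterS => j; rewrite exp_coeffE /= => h.
have h2 : x ^+ j * j`!%:R^-1 < d / (B + 1).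
  by rewrite mulrC; apply: le_lt_trans h; exact: ler_norm.
rewrite ltr_pdivlMr ?ltr_wpDl // in h2.
have [xj|xj] := leP 0 (x ^+ j * j`!%:R^-1).
  by apply: le_lt_trans h2; rewrite mulrC mulrDr mulr1 lerDl.
by apply: le_lt_trans d0; rewrite mulr_ge0_le0 // ltW.
Qed.

Lemma mirror_distance (m : int) (n : nat) : (`|m| < n)%N ->
  exists2 i : nat, 2 * n%:Z - 1 - m = i%:Z & (i <= 2 * n + `|m|)%N.
Proof. by move=> mn; exists `|(2 * n%:Z - 1 - m)%R|%N; lia. Qed.

(** The Wronskian bound enters through a square root, so a coefficient error of order [eta ^+ 2]
    leaves a factor [eta]; for [eta = 1 / j!] this still beats [(A ^+ p) ^+ j]. *)
Lemma decay_bound (A Z k c H eta : R) (B : R) (i j p q : nat) : 0 <= eta <= 1 ->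
  1 <= A -> 0 <= (Z + 1) * c -> 0 <= H -> 0 < k -> (i <= p * j + q)%N ->
  B = A ^+ q * (3 * Num.sqrt (A * ((Z + 1) * c) * H / k) + (Z + 1) * c * (1 + H)) ->
  A ^+ i * (3 * Num.sqrt (A * ((Z + 1) * (c * eta ^+ 2)) * H / k) +
    (Z + 1) * (c * eta ^+ 2) * (1 + H)) <= B * ((A ^+ p) ^+ j * eta).
Proof.
move=> /andP[n0 n1] A1 Zc H0 k0 ij ->.
have A0 : 0 <= A by exact: le_trans A1.
have -> : A * ((Z + 1) * (c * eta ^+ 2)) * H / k =
  eta ^+ 2 * (A * ((Z + 1) * c) * H / k) by ring.
rewrite sqrtrM ?sqr_ge0 // sqrtr_sqr ger0_norm //.
set S := Num.sqrt _; have S0 : 0 <= S by exact: sqrtr_ge0.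
have hn : 3 * (eta * S) + (Z + 1) * (c * eta ^+ 2) * (1 + H) <=
    eta * (3 * S + (Z + 1) * c * (1 + H)).
  rewrite [leRHS]mulrDr lerD //; first by rewrite mulrCA.
  have -> : (Z + 1) * (c * eta ^+ 2) * (1 + H) = eta * (eta * ((Z + 1) * c * (1 + H))).
    by ring.
  by rewrite ler_wpM2l // ler_piMl // mulr_ge0 // addr_ge0.
have hA : A ^+ i <= (A ^+ p) ^+ j * A ^+ q.
  by rewrite -exprM -exprD ler_weXn2l.
have lhs0 : 0 <= 3 * (eta * S) + (Z + 1) * (c * eta ^+ 2) * (1 + H).
  apply: addr_ge0; first by rewrite !mulr_ge0.
  apply: mulr_ge0; last by rewrite addr_ge0.
  by rewrite mulrA mulr_ge0 // sqr_ge0.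
apply: le_trans (ler_pM (exprn_ge0 _ A0) lhs0 hA hn) _.
by rewrite le_eqVlt; apply/orP; left; apply/eqP; ring.
Qed.

Lemma no_eigenvector (s : nat) (lambda1 lambda2 Phi theta : R)
    (rho u : int -> C) (z : C) :
  let alpha := mosaic_alpha s lambda1 lambda2 Phi theta in
  (0 < s)%N -> 0 < lambda1 < 1 -> 0 < lambda2 < 1 ->
  (forall k, exists2 j, (k <= j)%N & near_symmetric s Phi j theta) ->
  admissible alpha rho -> l2 u ->
  (forall m, gecmv alpha rho u m = z * u m) -> u = 0.
Proof.
move=> alpha s0 hl1 hl2 near adm u2 eig; apply/eqP/negPn/negP => u0.
pose a := mosaic_coef s lambda1 lambda2 Phi theta.
have aE m : alpha m = (a m)%:C by exact: mosaic_alphaE.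
have alpha_real m : (alpha m)^*%R = alpha m.
  by rewrite aE conj_Creal // complex_real.
pose r m := nrm (rho m).
have ra m : r m ^+ 2 = 1 - a m ^+ 2.
  apply/eqP; rewrite eq_sym subr_eq eq_sym addrC; apply/eqP/complexI.
  rewrite rmorphD /= -[RHS](adm m) aE !normE nrm_real -!rmorphXn /=.
  by rewrite real_normK ?num_real.
pose k := lambda1 * Num.sqrt (1 - lambda2 ^+ 2).
have k0 : 0 < k.
  case/andP: hl1 => l1 _; case/andP: hl2 => l2 l3.
  by rewrite mulr_gt0 // sqrtr_gt0 subr_gt0 expr_lt1 // ltW.
have kr m : k <= r m.
  rewrite -ler_sqr ?nnegrE ?nrm_ge0 ?(ltW k0) // ra.
  exact: mosaic_coef_le.
have r1 m : r m <= 1.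
  by rewrite -(@expr_le1 _ 2) ?nrm_ge0 // ra gerBl sqr_ge0.
have k1 : k <= 1 by exact: le_trans (kr 0) (r1 0).
have a1 m : nrm (alpha m) <= 1.
  rewrite aE nrm_real -(@expr_le1 _ 2) // real_normK ?num_real //.
  by have := sqr_ge0 (r m); rewrite ra subr_ge0.
have rho0 m : rho m != 0.
  by rewrite -nrm_eq0 gt_eqF //; exact: lt_le_trans (kr m).
have z0 := eigenvalue_neq0 alpha_real adm eig u0.
have [w [hw wu]] := eigen_transfer alpha_real adm eig rho0 z0.
have [u' [v' [uu vv huv]]] := gauge rho0 hw.
have [K uK] := l2_sum_le u2.
have u'K (m : int) n : \sum_(j < n) nrm (u' (m + j%:Z)) ^+ 2 <= K.
  by under eq_bigr do rewrite uu; exact: uK.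
have vu m : nrm (v' m) <= nrm (u' (m - 1)) + nrm (u' m) + nrm (u' (m + 1)).
  by rewrite vv !uu; apply: wu => //; exact: r1.
have Huv := sum_neighbours_le u'K vu.
set H := 12 * (K + K + K) in Huv.
have H0 : 0 <= H by have := Huv 0 0; rewrite big_ord0.
pose Z := 1 + nrm z + nrm z^-1.
have Z1 : 1 <= Z by rewrite /Z -addrA lerDl addr_ge0 ?nrm_ge0.
have hz : nrm z <= Z.
  by rewrite /Z addrAC lerDr addr_ge0 ?nrm_ge0.
have hzi : nrm z^-1 <= Z by rewrite /Z lerDr addr_ge0 ?nrm_ge0.
pose A := (Z + 1) / k.
have A1 : 1 <= A.
  by rewrite ler_pdivlMr // mul1r (le_trans k1) // ler_wpDl // (le_trans _ Z1).
(* [2 * pi] comes from [mosaic_reflect], the remaining [2 / k ^+ 3] from [quotient_perturb]. *)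
pose c : R := 2 * (2 * pi) / k ^+ 3.
have c0 : 0 <= c.
  by apply: divr_ge0; [rewrite !mulr_ge0 ?pi_ge0 | rewrite exprn_ge0 // ltW].
have Zc : 0 <= (Z + 1) * c by rewrite mulr_ge0 // addr_ge0 // (le_trans _ Z1).
suff u'0 m : nrm (u' m) = 0.
  move/eqP: u0; apply; apply/funext => m.
  by apply/eqP; rewrite -nrm_eq0 -uu u'0.
apply/eqP; rewrite eq_le nrm_ge0 andbT.
apply/ler_addgt0Pr => d d0; rewrite add0r.
have d2 : 0 < d / 2 by rewrite divr_gt0.
pose B := A ^+ `|m|%N *
  (3 * Num.sqrt (A * ((Z + 1) * c) * H / k) + (Z + 1) * c * (1 + H)).
have B0 : 0 <= B.
  apply: mulr_ge0; first by rewrite exprn_ge0 // (le_trans _ A1).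
  apply: addr_ge0; first by rewrite mulr_ge0 // sqrtr_ge0.
  by apply: mulr_ge0 => //; rewrite addr_ge0.
have [J0 _ hJ0] := l2_cvg0 (- 1 - m) d2 u'K.
have [J1 _ hJ1] := exp_div_fact_small (A ^+ (2 * s)) B0 d2.
(* [J0] makes [u'] small at the mirror image of [m], [J1] makes the reflection error small, and the
   last term places [m] to the left of the centre. *)
have [j jj [p hp]] := near (J0 + J1 + `|m|.+1)%N.
pose N := (s * j)%N; pose eta : R := j`!%:R^-1.
have Nj : (j <= N)%N by rewrite leq_pmull.
have jJ0 : (J0 <= j)%N by apply: leq_trans jj; rewrite -addnA leq_addr.
have jJ1 : (J1 <= j)%N by apply: leq_trans jj; rewrite addnAC leq_addl.
have jm : (`|m| < j)%N by apply: leq_trans jj; rewrite leq_addl.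
pose D := 2 * (N%:R * Phi + theta) - p%:~R.
have sym m' : `|(r (4 * N%:Z - 2 - m'))^-1 - (r m')^-1| <= c * eta ^+ 2 /\
    `|a (4 * N%:Z - 2 - m') / r (4 * N%:Z - 2 - m') - a m' / r m'| <= c * eta ^+ 2.
  have := @mosaic_reflect R s lambda1 lambda2 Phi theta j D p m' hl2 erefl.
  case/(quotient_perturb k0 k1 (kr _) (kr _) (ra _) (ra _)) => h1 h2.
  have hD : 2 * (2 * pi * `|D|) / k ^+ 3 <= c * eta ^+ 2.
    have -> : 2 * (2 * pi * `|D|) / k ^+ 3 = c * `|D| by rewrite /c; ring.
    by rewrite ler_wpM2l // ltW.
  by split; [exact: le_trans h1 hD | exact: le_trans h2 hD].
have ce : 0 <= c * eta ^+ 2 by rewrite mulr_ge0 // sqr_ge0.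
have [i iE iN] := mirror_distance (leq_trans jm Nj).
have := @reflected_decay R u' v' z a r k Z H (c * eta ^+ 2) N k0 k1 Z1 hz hzi z0
  kr ra Huv.
have huv' m' : (u' (m' + 1), v' (m' + 1)) =
    transfer (zeta z m') (a m')%:C (r m')%:C (u' m', v' m').
  by rewrite -aE; exact: huv.
move=> /(_ huv' ce (fun m' => (sym m').1) (fun m' => (sym m').2) i A _ erefl erefl).
have -> : 2 * N%:Z - 1 - i%:Z = m by rewrite -iE; ring.
(* The mirror image [4 N - 1 - m] is the entry of index [4 N] in the sequence starting at [- 1 - m],
   to which [hJ0] applies. *)
have -> : 2 * N%:Z + i%:Z = - 1 - m + (4 * N)%N%:Z by rewrite -iE PoszM; ring.
move=> /le_trans; apply; rewrite [d]splitr; apply: lerD.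
  by apply/ltW/hJ0; rewrite /= (leq_trans jJ0) // (leq_trans Nj) // leq_pmull.
have eta01 : 0 <= eta <= 1.
  rewrite invr_ge0 ler0n /= invf_le1 ?ltr0n ?fact_gt0 //.
  by rewrite ler1n fact_gt0.
have ij : (i <= 2 * s * j + `|m|)%N by rewrite -mulnA.
apply: le_trans (decay_bound eta01 A1 Zc H0 k0 ij erefl) _.
by apply/ltW/hJ1.
Qed.

End Absence.

Theorem corollary2p8 (R : realType) (s : nat) (lambda1 lambda2 Phi : R)
  (hs : (0 < s)%N)
  (hlambda1 : 0 < lambda1 < 1) (hlambda2 : 0 < lambda2 < 1)
  (hPhi : irrational Phi) :
  exists G : set (circle R), [/\ dense G, Gdelta G &
    forall theta : R, G (circle_pi theta) ->
    forall rho : int -> R[i],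
      let alpha := mosaic_alpha s lambda1 lambda2 Phi theta in
      admissible alpha rho -> point_spectrum (gecmv alpha rho) = set0].
Proof.
have [G [dG GG hG]] := generic_near_symmetric hs hPhi.
exists G; split=> // theta /hG near rho alpha adm.
apply/seteqP; split=> // z [u [u2 /eqP u0 eig]]; apply: u0.
exact: (no_eigenvector hs hlambda1 hlambda2 near adm u2 eig).
Qed.
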